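(* Let $R$ be an associative ring with identity and let $Q$ be any quiver. The following statements hold in the category $\mathrm{Rep}(Q,R)$: (1) The class of all strongly fp-injective representations is closed under extensions, finite direct sums and direct summands. (2) The class of all strongly fp-injective representations is closed under taking cokernels of monomorphisms (i.e. if $0\to X\to Y\to Z\to 0$ is exact in $\mathrm{Rep}(Q,R)$ with $X$ and $Y$ strongly fp-injective, then $Z$ is strongly fp-injective). (3) Let $0\to X\to Y\to Z\to 0$ be a pure exact sequence of representations. If $Y$ and $Z$ are strongly fp-injective, then so is $X$. (4) A representation $X$ is strongly fp-injective if and only if there exists a pure exact sequence $0\to X\to T^0\to T^1\to\cdots$ in $\mathrm{Rep}(Q,R)$ with $T^i$ strongly fp-injective for each integer $i\ge 0$.
   Context: Modules are left $R$-modules; right $R$-modules are called $R^{\mathrm{op}}$-modules. A quiver $Q=(Q_0,Q_1)$ is a directed graph with vertex set $Q_0$ and arrow set $Q_1$; $\mathrm{Rep}(Q,R)$ is the abelian category of representations of $Q$ by $R$-modules, i.e. covariant functors from the (path category of the) quiver $Q$ to $R$-modules, with natural transformations as morphisms. $Q^{\mathrm{op}}$ is the quiver with the same vertices and all arrows reversed. Tensor product: for $X\in\mathrm{Rep}(Q,R)$ and an abelian group $G$, let $\mathrm{Hom}(X,G)\in\mathrm{Rep}(Q^{\mathrm{op}},R^{\mathrm{op}})$ be the representation with $\mathrm{Hom}(X,G)(i)=\mathrm{Hom}_{\mathbb Z}(X(i),G)$ and the induced maps on reversed arrows. The functor $\mathrm{Hom}(X,-):\mathbb{Z}\text{-Mod}\to\mathrm{Rep}(Q^{\mathrm{op}},R^{\mathrm{op}})$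 has a left adjoint, denoted $-\otimes_Q X:\mathrm{Rep}(Q^{\mathrm{op}},R^{\mathrm{op}})\to\mathbb{Z}\text{-Mod}$. Purity: a short exact sequence $\eta$ in $\mathrm{Rep}(Q,R)$ is pure if $S\otimes_Q\eta$ is exact for every $S\in\mathrm{Rep}(Q^{\mathrm{op}},R^{\mathrm{op}})$. A long exact sequence is pure (pure acyclic) if all the short exact sequences into which it decomposes are pure. A representation $X\in\mathrm{Rep}(Q,R)$ is strongly fp-injective if there is a pure exact sequence $0\to X\to E^0\to E^1\to\cdots$ in $\mathrm{Rep}(Q,R)$ with every $E^i$ ($i\ge 0$) injective in $\mathrm{Rep}(Q,R)$. *)

(* Defs.v *)
(* The eqType and choiceType structures that lmodType and zmodType require carry
   no mathematical content: boolp provides them classically on any type. *)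
From HB Require Import structures.
From mathcomp Require Import all_boot all_order all_algebra.
From mathcomp Require Import generic_quotient ring_quotient boolp freeg.

Set Implicit Arguments.
Unset Strict Implicit.
Unset Printing Implicit Defensive.

Import GRing.Theory.
Local Open Scope ring_scope.
Local Open Scope quotient_scope.

Record quiver := Quiver {
  vertex : Type;
  arrow : vertex -> vertex -> Type
}.

Definition opr (R : pzRingType) : pzRingType := R^c.

Definition opq (Q : quiver) : quiver :=
  @Quiver (vertex Q) (fun i j => arrow j i).

(* Left modules over a possibly zero, possibly noncommutative ring R are
   lmodType R; right modules are lmodType (opr R).  A functor out of the (free)
   path category of Q is freely determined by its values on vertices and arrows. *)
Record rep (Q : quiver) (R : pzRingType) := Rep {
  rep_obj :> vertex Q -> lmodType R;
  rep_map : forall i j, arrow i j -> {linear rep_obj i -> rep_obj j}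
}.

Record rep_hom (Q : quiver) (R : pzRingType) (X Y : rep Q R) := RepHom {
  hom_fun :> forall i, {linear X i -> Y i};
  hom_nat : forall i j (a : arrow i j) (x : X i),
    hom_fun j (rep_map X a x) = rep_map Y a (hom_fun i x)
}.

Definition hom_eq (Q : quiver) (R : pzRingType) (X Y : rep Q R)
  (f g : rep_hom X Y) : Prop := forall i, f i =1 g i.

Notation "f =h g" := (hom_eq f g) (at level 70, no associativity).

Section Category.
Variables (Q : quiver) (R : pzRingType).
Implicit Types X Y Z W : rep Q R.

Definition hid X : rep_hom X X :=
  @RepHom Q R X X (fun i => idfun) (fun i j a x => erefl).

Lemma hcomp_nat X Y Z (g : rep_hom Y Z) (f : rep_hom X Y) i j (a : arrow i j) (x : X i) :
  (g j \o f j) (rep_map X a x) = rep_map Z a ((g i \o f i) x).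
Proof. by rewrite /= !hom_nat. Qed.

Definition hcomp X Y Z (g : rep_hom Y Z) (f : rep_hom X Y) : rep_hom X Z :=
  @RepHom Q R X Z (fun i => g i \o f i) (@hcomp_nat X Y Z g f).

Lemma hzero_nat X Y i j (a : arrow i j) (x : X i) :
  (\0 : X j -> Y j) (rep_map X a x) = rep_map Y a ((\0 : X i -> Y i) x).
Proof. by rewrite /= linear0. Qed.

Definition hzero X Y : rep_hom X Y :=
  @RepHom Q R X Y (fun i => \0) (@hzero_nat X Y).

Definition rep_mono X Y (f : rep_hom X Y) : Prop :=
  forall W (u v : rep_hom W X), hcomp f u =h hcomp f v -> u =h v.

Definition injective_rep E : Prop :=
  forall X Y (f : rep_hom X Y), rep_mono f ->
  forall g : rep_hom X E, exists h : rep_hom Y E, hcomp h f =h g.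

Definition is_direct_sum (I : finType) (X : I -> rep Q R) W
    (inc : forall k, rep_hom (X k) W) (pr : forall k, rep_hom W (X k)) : Prop :=
  [/\ forall k, hcomp (pr k) (inc k) =h hid (X k),
      forall k l, k != l -> hcomp (pr k) (inc l) =h hzero (X l) (X k) &
      forall i (w : W i), \sum_k inc k i (pr k i w) = w].

Definition direct_sum (I : finType) (X : I -> rep Q R) W : Prop :=
  exists inc, exists pr, @is_direct_sum I X W inc pr.

Definition direct_summand X Y : Prop :=
  exists X', direct_sum (fun b : bool => if b then X else X') Y.

End Category.

(* 0 -> A -> B -> C -> 0 *)
Definition short_exact (A B C : zmodType) (f : A -> B) (g : B -> C) : Prop :=
  [/\ injective f,
      forall b, g b = 0 <-> exists a, f a = b &
      forall c, exists b, g b = c].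

Section ExactRep.
Variables (Q : quiver) (R : pzRingType).
Implicit Types X Y Z : rep Q R.

(* Kernels and images in Rep(Q,R) are computed vertexwise. *)
Definition ses X Y Z (f : rep_hom X Y) (g : rep_hom Y Z) : Prop :=
  forall i, short_exact (f i) (g i).

(* 0 -> X -> E 0 -> E 1 -> ... *)
Definition long_exact X (E : nat -> rep Q R) (eps : rep_hom X (E 0%N))
    (d : forall n, rep_hom (E n) (E n.+1)) : Prop :=
  [/\ forall i, injective (eps i),
      forall i (y : E 0%N i), d 0%N i y = 0 <-> exists x, eps i x = y &
      forall n i (y : E n.+1 i), d n.+1 i y = 0 <-> exists x, d n i x = y].

End ExactRep.

(* Hom_Z(U, G), a left module over opr R through (r *: f) u = f (r *: u). *)
Definition homZ (R : pzRingType) (U : lmodType R) (G : zmodType) : Type :=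
  {additive U -> G}.

Section HomZ.
Variables (R : pzRingType) (U : lmodType R) (G : zmodType).

Definition homZ_fun (f : homZ U G) : {additive U -> G} := f.
Coercion homZ_fun : homZ >-> GRing.Additive.type.

Lemma homZ_ext (f g : homZ U G) : f =1 g -> f = g.
Proof.
case: f g => f [[f0]] [g [[g0]]] /= /funext fg; rewrite /homZ_fun /= in fg *.
by case: _ / fg g0 => g0; rewrite (Prop_irrelevance f0 g0).
Qed.

HB.instance Definition _ := gen_eqMixin (homZ U G).
HB.instance Definition _ := gen_choiceMixin (homZ U G).

Definition homZ_zero : homZ U G := (\0 : {additive U -> G}).
Definition homZ_add (f g : homZ U G) : homZ U G := (f \+ g : {additive U -> G}).
Definition homZ_opp (f : homZ U G) : homZ U G := (\- f : {additive U -> G}).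

Lemma homZ_addA : associative homZ_add.
Proof. by move=> f g h; apply: homZ_ext => x /=; rewrite addrA. Qed.
Lemma homZ_addC : commutative homZ_add.
Proof. by move=> f g; apply: homZ_ext => x /=; rewrite addrC. Qed.
Lemma homZ_add0 : left_id homZ_zero homZ_add.
Proof. by move=> f; apply: homZ_ext => x /=; rewrite add0r. Qed.
Lemma homZ_addN : left_inverse homZ_zero homZ_opp homZ_add.
Proof. by move=> f; apply: homZ_ext => x /=; rewrite addNr. Qed.

HB.instance Definition _ := GRing.isZmodule.Build (homZ U G)
  homZ_addA homZ_addC homZ_add0 homZ_addN.

Definition homZ_scale (r : opr R) (f : homZ U G) : homZ U G :=
  (f \o ( *:%R (r : R)) : {additive U -> G}).

Lemma homZ_scaleA r s f :
  homZ_scale r (homZ_scale s f) = homZ_scale (r * s) f.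
Proof. by apply: homZ_ext => x /=; rewrite scalerA. Qed.
Lemma homZ_scale1 : left_id 1 homZ_scale.
Proof. by move=> f; apply: homZ_ext => x /=; rewrite scale1r. Qed.
Lemma homZ_scaleDr : right_distributive homZ_scale +%R.
Proof. by move=> r f g; apply: homZ_ext => x. Qed.
Lemma homZ_scaleDl f : {morph homZ_scale^~ f : r s / r + s}.
Proof. by move=> r s; apply: homZ_ext => x /=; rewrite scalerDl raddfD. Qed.

HB.instance Definition _ := GRing.Zmodule_isLmodule.Build (opr R) (homZ U G)
  homZ_scaleA homZ_scale1 homZ_scaleDr homZ_scaleDl.

Lemma homZ_addE (f g : homZ U G) x : (f + g : homZ U G) x = f x + g x.
Proof. by []. Qed.

Lemma homZ_scaleE (r : R) (f : homZ U G) x :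
  ((r : opr R) *: f : homZ U G) x = f (r *: x).
Proof. by []. Qed.

End HomZ.

Section HomRep.
Variables (Q : quiver) (R : pzRingType).

Definition homZ_pre (U V : lmodType R) (G : zmodType) (u : {linear U -> V})
  (f : homZ V G) : homZ U G := (f \o u : {additive U -> G}).

Lemma homZ_pre_linear (U V : lmodType R) G (u : {linear U -> V}) :
  linear (@homZ_pre U V G u).
Proof. by move=> r f g; apply: homZ_ext => x /=; rewrite linearZ. Qed.

HB.instance Definition _ (U V : lmodType R) G (u : {linear U -> V}) :=
  GRing.isLinear.Build (opr R) (homZ V G) (homZ U G) *:%R (@homZ_pre U V G u)
    (homZ_pre_linear u).

Definition hom_rep (X : rep Q R) (G : zmodType) : rep (opq Q) (opr R) :=
  @Rep (opq Q) (opr R) (fun i => homZ (X i) G)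
    (fun j i (a : @arrow (opq Q) j i) =>
       @homZ_pre (X i) (X j) G (@rep_map Q R X i j a)).

End HomRep.

Section Tensor.
Variables (Q : quiver) (R : pzRingType).

Section Def.
Variables (S : rep (opq Q) (opr R)) (X : rep Q R).

Definition tensor_key : Type := {classic {i : vertex Q & (S i * X i)%type}}.

Definition tensor_gen (i : vertex Q) (s : S i) (x : X i) : {freeg tensor_key} :=
  << (existT _ i (s, x) : tensor_key) >>.

Inductive tensor_relator : {freeg tensor_key} -> Prop :=
| RelAddl (i : vertex Q) (s s' : S i) (x : X i) :
    tensor_relator (tensor_gen (s + s') x - tensor_gen s x - tensor_gen s' x)
| RelAddr (i : vertex Q) (s : S i) (x x' : X i) :
    tensor_relator (tensor_gen s (x + x') - tensor_gen s x - tensor_gen s x')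
| RelScale (r : R) (i : vertex Q) (s : S i) (x : X i) :
    tensor_relator (tensor_gen ((r : opr R) *: s) x - tensor_gen s (r *: x))
| RelArrow (i j : vertex Q) (a : @arrow Q i j) (s : S j) (x : X i) :
    tensor_relator
      (tensor_gen (@rep_map (opq Q) (opr R) S j i a s) x
       - tensor_gen s (rep_map X a x)).

(* The subgroup generated by the relators. *)
Definition tensor_sub : pred {freeg tensor_key} := fun z =>
  `[< forall H : {pred {freeg tensor_key}}, zmod_closed H ->
        (forall r, tensor_relator r -> r \in H) -> z \in H >].

Lemma tensor_sub_closed : zmod_closed tensor_sub.
Proof.
split=> [|x y /asboolP Hx /asboolP Hy]; apply/asboolP => H Hc Hr.
  by case: Hc.
by case: (Hc) => _; apply; [apply: Hx|apply: Hy].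
Qed.

HB.instance Definition _ :=
  GRing.isZmodClosed.Build {freeg tensor_key} tensor_sub tensor_sub_closed.

Definition tensor_subg : zmodClosed {freeg tensor_key} :=
  GRing.ZmodClosed.clone _ tensor_sub _.

Definition tensor : zmodType := Quotient.quot tensor_subg.

Definition tensor_pi : {additive {freeg tensor_key} -> tensor} :=
  \pi_(Quotient.quot tensor_subg).

Definition tens (i : vertex Q) (s : S i) (x : X i) : tensor :=
  tensor_pi (tensor_gen s x).

Lemma tensor_pi_relator z : tensor_relator z -> tensor_pi z = 0.
Proof.
move=> Hz; rewrite -[RHS](raddf0 tensor_pi).
apply/eqP; rewrite -Quotient.idealrBE subr0.
by apply/asboolP => H _; apply.
Qed.

Lemma tensDl (i : vertex Q) (s s' : S i) (x : X i) :
  tens (s + s') x = tens s x + tens s' x.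
Proof.
apply/eqP; rewrite -subr_eq0 opprD addrA /tens -!(raddfB tensor_pi).
exact/eqP/tensor_pi_relator/RelAddl.
Qed.

Lemma tensDr (i : vertex Q) (s : S i) (x x' : X i) :
  tens s (x + x') = tens s x + tens s x'.
Proof.
apply/eqP; rewrite -subr_eq0 opprD addrA /tens -!(raddfB tensor_pi).
exact/eqP/tensor_pi_relator/RelAddr.
Qed.

Lemma tensZ (r : R) (i : vertex Q) (s : S i) (x : X i) :
  tens ((r : opr R) *: s) x = tens s (r *: x).
Proof.
apply/eqP; rewrite -subr_eq0 /tens -!(raddfB tensor_pi).
exact/eqP/tensor_pi_relator/RelScale.
Qed.

Lemma tens_map (i j : vertex Q) (a : @arrow Q i j) (s : S j) (x : X i) :
  tens (@rep_map (opq Q) (opr R) S j i a s) x = tens s (rep_map X a x).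
Proof.
apply/eqP; rewrite -subr_eq0 /tens -!(raddfB tensor_pi).
exact/eqP/tensor_pi_relator/RelArrow.
Qed.

Lemma tensor_piP (t : tensor) : exists z, t = tensor_pi z.
Proof. by exists (repr (t : Quotient.quot tensor_subg)); rewrite /= reprK. Qed.

Lemma tens_ind (P : tensor -> Prop) :
  P 0 -> (forall t u, P t -> P u -> P (t - u)) ->
  (forall (i : vertex Q) (s : S i) (x : X i), P (tens s x)) -> forall t, P t.
Proof.
move=> P0 PB Pt t.
have PN u : P u -> P (- u) by move=> Pu; rewrite -sub0r; apply: PB.
have PD u v : P u -> P v -> P (u + v).
  by move=> Pu Pv; rewrite -[v]opprK; apply/PB/PN.
have [z ->] := tensor_piP t; rewrite -[z]freeg_sumE raddf_sum.
elim/big_ind: _ => // -[i [s x]] _; set c := coeff _ _.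
rewrite -[c]intz -freegU_mulz raddfMz.
have Pgen := Pt i s x; rewrite /tens /tensor_gen in Pgen.
have Pn n : P (tens s x *+ n).
  by elim: n => [|n IH]; rewrite ?mulr0n ?mulrS //; apply: PD.
case: c => n; first exact: (Pn n).
by rewrite NegzE mulrNz; apply: PN; apply: (Pn n.+1).
Qed.

Section Lift.
Variables (G : zmodType) (g : rep_hom S (hom_rep X G)).

Definition tensor_lift0 : {freeg tensor_key} -> G :=
  fglift (fun k : tensor_key => homZ_fun (g (tag k) (tagged k).1) (tagged k).2
     : zmodule G).

Lemma tensor_lift0B : {morph tensor_lift0 : y z / y - z}.
Proof. by move=> x y; move: (lift_is_additive (fun k : tensor_key =>
  homZ_fun (g (tag k) (tagged k).1) (tagged k).2 : zmodule G) x y). Qed.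

Lemma tensor_lift0_gen (i : vertex Q) (s : S i) (x : X i) :
  tensor_lift0 (tensor_gen s x) = g i s x.
Proof. by rewrite /tensor_lift0 /tensor_gen liftU /= scale1r. Qed.

Lemma tensor_lift0_sub z : z \in tensor_sub -> tensor_lift0 z = 0.
Proof.
move=> /asboolP/(_ (fun z => tensor_lift0 z == 0)) H; apply/eqP; apply: H.
  split=> [|x y /eqP Hx /eqP Hy]; apply/eqP.
    by have := tensor_lift0B 0 0; rewrite !subrr.
  by rewrite tensor_lift0B Hx Hy subrr.
move=> _ [i s s' x|i s x x'|r i s x|i j a s x]; apply/eqP;
  rewrite !tensor_lift0B !tensor_lift0_gen.
- by rewrite raddfD homZ_addE addrAC addrK subrr.
- by rewrite raddfD addrAC addrK subrr.
- by rewrite linearZ homZ_scaleE subrr.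
- by rewrite (hom_nat g) subrr.
Qed.

Definition tensor_lift_fun (t : tensor) : G :=
  tensor_lift0 (repr (t : Quotient.quot tensor_subg)).

Lemma tensor_lift_pi z :
  tensor_lift_fun (tensor_pi z) = tensor_lift0 z.
Proof.
apply/eqP; rewrite -subr_eq0 /tensor_lift_fun -tensor_lift0B tensor_lift0_sub //.
by rewrite Quotient.idealrBE reprK.
Qed.

Lemma tensor_lift_additive : zmod_morphism tensor_lift_fun.
Proof.
move=> t u; have [y ->] := tensor_piP t; have [z ->] := tensor_piP u.
rewrite -raddfB !tensor_lift_pi.
exact: tensor_lift0B.
Qed.

HB.instance Definition _ :=
  GRing.isZmodMorphism.Build tensor G tensor_lift_fun tensor_lift_additive.

Definition tensor_lift : {additive tensor -> G} := tensor_lift_fun.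

Lemma tensor_lift_tens (i : vertex Q) (s : S i) (x : X i) :
  tensor_lift (tens s x) = g i s x.
Proof. by rewrite /= tensor_lift_pi tensor_lift0_gen. Qed.

Lemma tensor_lift_uniq (h : {additive tensor -> G}) :
  (forall (i : vertex Q) (s : S i) (x : X i), h (tens s x) = g i s x) ->
  h =1 tensor_lift.
Proof.
move=> hg; apply: tens_ind => [|t u Ht Hu|i s x].
- by rewrite !raddf0.
- by rewrite !raddfB Ht Hu.
- by rewrite hg tensor_lift_tens.
Qed.

End Lift.

Definition tensor_unit_fun (i : vertex Q) (s : S i) (x : X i) : tensor :=
  tens s x.

Lemma tensor_unit_funB (i : vertex Q) (s : S i) :
  zmod_morphism (tensor_unit_fun s).
Proof.
move=> x y; apply/eqP; rewrite eq_sym subr_eq; apply/eqP.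
by rewrite /tensor_unit_fun -tensDr subrK.
Qed.

HB.instance Definition _ (i : vertex Q) (s : S i) :=
  GRing.isZmodMorphism.Build (X i) tensor (tensor_unit_fun s)
    (tensor_unit_funB s).

Definition tensor_unit_obj (i : vertex Q) (s : S i) : hom_rep X tensor i :=
  (tensor_unit_fun s : {additive X i -> tensor}).

Lemma tensor_unit_linear (i : vertex Q) : linear (@tensor_unit_obj i).
Proof.
move=> r s s'; apply: homZ_ext => x.
rewrite homZ_addE (@homZ_scaleE R); rewrite /tensor_unit_obj /=.
by rewrite /tensor_unit_fun tensDl tensZ.
Qed.

HB.instance Definition _ (i : vertex Q) :=
  GRing.isLinear.Build (opr R) (S i) (hom_rep X tensor i) *:%R
    (@tensor_unit_obj i) (@tensor_unit_linear i).

Lemma tensor_unit_nat (i j : vertex (opq Q)) (a : arrow i j) (s : S i) :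
  tensor_unit_obj (rep_map S a s) =
  rep_map (hom_rep X tensor) a (tensor_unit_obj s).
Proof. by apply: homZ_ext => x; apply: (@tens_map j i a). Qed.

(* Together with tensor_lift, tensor_lift_tens and tensor_lift_uniq, this is the
   universal arrow from S to the functor Hom(X, -), so that S |-> tensor S X is
   its left adjoint. *)
Definition tensor_unit : rep_hom S (hom_rep X tensor) :=
  @RepHom (opq Q) (opr R) S (hom_rep X tensor) (fun i => @tensor_unit_obj i)
    tensor_unit_nat.

End Def.

Section Functor.
Variables (X Y : rep Q R) (f : rep_hom X Y) (G : zmodType).

Lemma hom_rep_map_nat (i j : vertex (opq Q)) (a : arrow i j)
    (h : hom_rep Y G i) :
  homZ_pre (f j) (rep_map (hom_rep Y G) a h) =
  rep_map (hom_rep X G) a (homZ_pre (f i) h).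
Proof. by apply: homZ_ext => x /=; rewrite -(hom_nat f). Qed.

Definition hom_rep_map : rep_hom (hom_rep Y G) (hom_rep X G) :=
  @RepHom (opq Q) (opr R) (hom_rep Y G) (hom_rep X G)
    (fun i => @homZ_pre R (X i) (Y i) G (f i)) hom_rep_map_nat.

End Functor.

Definition tensor_map (S : rep (opq Q) (opr R)) (X Y : rep Q R) (f : rep_hom X Y) :
    {additive tensor S X -> tensor S Y} :=
  tensor_lift (hcomp (hom_rep_map f (tensor S Y)) (tensor_unit S Y)).

Lemma tensor_map_tens (S : rep (opq Q) (opr R)) (X Y : rep Q R) (f : rep_hom X Y)
    (i : vertex Q) (s : S i) (x : X i) :
  tensor_map S f (tens s x) = tens s (f i x).
Proof. exact: tensor_lift_tens. Qed.

End Tensor.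

Section Purity.
Variables (Q : quiver) (R : pzRingType).
Implicit Types X Y Z : rep Q R.

Definition pure_ses X Y Z (f : rep_hom X Y) (g : rep_hom Y Z) : Prop :=
  ses f g /\
  forall S : rep (opq Q) (opr R), short_exact (tensor_map S f) (tensor_map S g).

(* 0 -> X -> E 0 -> E 1 -> ... decomposes into 0 -> X -> E 0 -> K 0 -> 0 and
   0 -> K n -> E n.+1 -> K n.+1 -> 0; the K n are unique up to isomorphism. *)
Definition pure_exact X (E : nat -> rep Q R) (eps : rep_hom X (E 0%N))
    (d : forall n, rep_hom (E n) (E n.+1)) : Prop :=
  long_exact eps d /\
  exists (K : nat -> rep Q R) (p : forall n, rep_hom (E n) (K n))
         (i : forall n, rep_hom (K n) (E n.+1)),
    [/\ forall n, d n =h hcomp (i n) (p n),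
        pure_ses eps (p 0%N) &
        forall n, pure_ses (i n) (p n.+1)].

Definition strongly_fp_injective X : Prop :=
  exists (E : nat -> rep Q R) (eps : rep_hom X (E 0%N))
         (d : forall n, rep_hom (E n) (E n.+1)),
    pure_exact eps d /\ forall n, injective_rep (E n).

End Purity.

(* Main.v *)
(* The tensor product is right exact, so a short exact sequence is pure as soon
   as its monomorphism stays injective after tensoring.  Hence strongly
   fp-injective representations form the largest class whose members X sit in
   pure sequences 0 -> X -> E -> K -> 0 with E injective and K in the class, and
   a closure property follows once a class containing the representations in
   question is shown to have this property.  For an extension 0 -> X -> Y -> Z
   -> 0 and such sequences for X and Z, an extension h : Y -> E of X -> E gives
   0 -> Y -> E + Z -> K -> 0, which is pure, and then Y -> E + E' with Z -> E'
   (a horseshoe lemma).  The same sequence exhibits E + Z as an extension of K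
   by Y, so that cokernels of monomorphisms reduce to retracts. *)
Require Import Defs.
From mathcomp Require Import all_boot all_algebra.
From HB Require Import structures.
From mathcomp Require Import generic_quotient ring_quotient boolp.

Set Implicit Arguments.
Unset Strict Implicit.
Unset Printing Implicit Defensive.

Import GRing.Theory.
Local Open Scope ring_scope.
Local Open Scope quotient_scope.

(** * Maps built from functions *)

Lemma exists_linear (R : pzRingType) (U V : lmodType R) (f : U -> V) :
  linear f -> {g : {linear U -> V} | g =1 f}.
Proof.
move=> lf.
pose m := GRing.isLinear.Build R U V *:%R f lf.
pose g : {linear U -> V} := HB.pack f m.
by exists g.
Qed.

Lemma linear_inj (R : pzRingType) (U V : lmodType R) (f : {linear U -> V}) :
  (forall u, f u = 0 -> u = 0) -> injective f.
Proof. exact: raddf_inj. Qed.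

Lemma exists_additive (U V : zmodType) (f : U -> V) :
  zmod_morphism f -> {g : {additive U -> V} | g =1 f}.
Proof.
move=> lf.
pose m := GRing.isZmodMorphism.Build U V f lf.
pose g : {additive U -> V} := HB.pack f m.
by exists g.
Qed.

Lemma exists_rep_hom (Q : quiver) (R : pzRingType) (X Y : rep Q R)
    (f : forall i, X i -> Y i) :
  (forall i, linear (f i)) ->
  (forall i j (a : arrow i j) x, f j (rep_map X a x) = rep_map Y a (f i x)) ->
  {h : rep_hom X Y | forall i, h i =1 f i}.
Proof.
move=> lf nf; pose g i := sval (exists_linear (lf i)).
have gE i : g i =1 f i := svalP (exists_linear (lf i)).
have ng i j (a : arrow i j) x : g j (rep_map X a x) = rep_map Y a (g i x).
  by rewrite !gE nf.
exists (RepHom ng) => i x; exact: gE.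
Qed.

(** A section [s] of [g] need not be linear, but [h \o s] is: [h] is constant on the fibres of [g],
    so any preimage may replace the chosen one. *)
Lemma surjective_factor (R : pzRingType) (U V W : lmodType R)
    (g : {linear U -> V}) (h : {linear U -> W}) :
  (forall v, exists u, g u = v) -> (forall u, g u = 0 -> h u = 0) ->
  {k : {linear V -> W} | forall u, k (g u) = h u}.
Proof.
move=> surj ker; have [s sK] := choice surj.
have hs u v : g u = v -> h (s v) = h u.
  move=> <-; apply/eqP; rewrite -subr_eq0 -linearB; apply/eqP/ker.
  by rewrite linearB sK subrr.
have lin : linear (h \o s).
  move=> r v w /=; rewrite -linearP; apply: hs.
  by rewrite linearP !sK.
have [k kE] := exists_linear lin.
by exists k => u; rewrite kE /=; apply: hs.
Qed.

(** * Cokernels of additive and linear maps *)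

Section Image.
Variables (U V : zmodType) (f : {additive U -> V}).

Definition image_pred : pred V := fun v => `[< exists u, f u = v >].

Lemma image_pred_closed : zmod_closed image_pred.
Proof.
split=> [|_ _ /asboolP[u <-] /asboolP[v <-]]; apply/asboolP.
  by exists 0; rewrite raddf0.
by exists (u - v); rewrite raddfB.
Qed.

HB.instance Definition _ :=
  GRing.isZmodClosed.Build V image_pred image_pred_closed.

Definition image_zmod : zmodClosed V := GRing.ZmodClosed.clone _ image_pred _.

Definition coker : zmodType := Quotient.quot image_zmod.

Definition coker_pi : {additive V -> coker} := \pi_(Quotient.quot image_zmod).

Lemma coker_pi_surj x : exists v, coker_pi v = x.
Proof. by exists (repr (x : Quotient.quot image_zmod)); rewrite /= reprK. Qed.

Lemma coker_pi_eq0 v : coker_pi v = 0 <-> exists u, f u = v.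
Proof.
rewrite -(raddf0 coker_pi); split=> [/eqP|H].
  by rewrite -Quotient.idealrBE subr0 => /asboolP.
by apply/eqP; rewrite -Quotient.idealrBE subr0; apply/asboolP.
Qed.

End Image.

Section LinearCokernel.
Variables (R : pzRingType) (U V : lmodType R) (f : {linear U -> V}).

(** This alias of the quotient group is the carrier of the R-module structure below. *)
Definition lcoker : Type := coker f.
HB.instance Definition _ := GRing.Zmodule.on lcoker.

Definition lcoker_pi : {additive V -> lcoker} := coker_pi f.

Lemma lcoker_pi_surj x : exists v, lcoker_pi v = x.
Proof. exact: coker_pi_surj. Qed.

Definition lcoker_scale (r : R) (x : lcoker) : lcoker :=
  lcoker_pi (r *: sval (cid (lcoker_pi_surj x))).

(** Two representatives differ by an element of the image, which is stable under scaling; hence the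
    choice in [lcoker_scale] is immaterial, and the module axioms descend from [V]. *)
Lemma lcoker_pi_scale r v : lcoker_scale r (lcoker_pi v) = lcoker_pi (r *: v).
Proof.
have wv := svalP (cid (lcoker_pi_surj (lcoker_pi v))).
rewrite /lcoker_scale; move: (sval _) wv => w wv; apply/eqP.
rewrite -subr_eq0 -raddfB; apply/eqP/coker_pi_eq0.
have /coker_pi_eq0[u fu] : coker_pi f (w - v) = 0.
  by rewrite raddfB wv; apply: subrr.
exists (r *: u); transitivity (r *: f u); first exact: linearZ.
by rewrite [f u]fu; apply: scalerBr.
Qed.

Lemma lcoker_scaleA r s x :
  lcoker_scale r (lcoker_scale s x) = lcoker_scale (r * s) x.
Proof. by have [v <-] := lcoker_pi_surj x; rewrite !lcoker_pi_scale scalerA. Qed.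

Lemma lcoker_scale1 : left_id 1 lcoker_scale.
Proof.
by move=> x; have [v <-] := lcoker_pi_surj x; rewrite lcoker_pi_scale scale1r.
Qed.

Lemma lcoker_scaleDr : right_distributive lcoker_scale +%R.
Proof.
move=> r x y; have [v <-] := lcoker_pi_surj x; have [w <-] := lcoker_pi_surj y.
by rewrite -(raddfD lcoker_pi) !lcoker_pi_scale scalerDr raddfD.
Qed.

Lemma lcoker_scaleDl x : {morph lcoker_scale^~ x : r s / r + s}.
Proof.
move=> r s; have [v <-] := lcoker_pi_surj x.
by rewrite !lcoker_pi_scale scalerDl raddfD.
Qed.

HB.instance Definition _ := GRing.Zmodule_isLmodule.Build R lcoker
  lcoker_scaleA lcoker_scale1 lcoker_scaleDr lcoker_scaleDl.

Lemma lcoker_pi_linear : linear lcoker_pi.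
Proof. by move=> r v w; rewrite raddfD -lcoker_pi_scale. Qed.

End LinearCokernel.

Lemma exists_coker (R : pzRingType) (U V : lmodType R) (f : {linear U -> V}) :
  {W : lmodType R & {g : {linear V -> W} |
    (forall w, exists v, g v = w) /\ forall v, g v = 0 <-> exists u, f u = v}}.
Proof.
have [g gE] := exists_linear (lcoker_pi_linear f).
exists (lcoker f), g; split=> [w|v]; last by rewrite gE; apply: coker_pi_eq0.
by have [v vE] := coker_pi_surj w; exists v; rewrite gE.
Qed.

(** * Componentwise maps of products *)

Section PairMap.
Variables (R : pzRingType) (A B C D : lmodType R).
Variables (u : {linear A -> C}) (v : {linear B -> D}).

Definition pair_map (x : A * B) : C * D := (u x.1, v x.2).

Lemma pair_map_linear : linear pair_map.
Proof. by move=> r x y; rewrite /pair_map /= !linearP. Qed.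

HB.instance Definition _ :=
  GRing.isLinear.Build R (A * B)%type (C * D)%type *:%R pair_map pair_map_linear.

End PairMap.

(** * Factorization and cokernels of representations *)

Section Representations.
Variables (Q : quiver) (R : pzRingType).
Implicit Types X Y Z W E K L : rep Q R.

Lemma rep_factor X Y Z (g : rep_hom X Y) (h : rep_hom X Z) :
  (forall i y, exists x, g i x = y) -> (forall i x, g i x = 0 -> h i x = 0) ->
  exists k : rep_hom Y Z, forall i x, k i (g i x) = h i x.
Proof.
move=> surj ker; pose k i := sval (surjective_factor (surj i) (ker i)).
have kE i x : k i (g i x) = h i x := svalP (surjective_factor _ _) x.
have nk i j (a : arrow i j) y : k j (rep_map Y a y) = rep_map Z a (k i y).
  by have [x <-] := surj i y; rewrite -hom_nat !kE hom_nat.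
by exists (RepHom nk).
Qed.

(** Cokernels are formed vertexwise. By naturality of [f], the map of [Y] along an arrow sends image
    to image, so it descends to the quotients. *)
Lemma exists_rep_coker X Y (f : rep_hom X Y) :
  (forall i, injective (f i)) -> exists Z (g : rep_hom Y Z), ses f g.
Proof.
move=> injf.
pose g i := sval (tagged (exists_coker (f i))).
have gP i := svalP (tagged (exists_coker (f i))).
have ker i j (a : arrow i j) y : g i y = 0 -> (g j \o rep_map Y a) y = 0.
  move=> /(gP i).2[x <-]; apply/(gP j).2; exists (rep_map X a x).
  exact: hom_nat.
pose m i j (a : arrow i j) := surjective_factor (gP i).1 (ker i j a).
pose Z := Rep (fun i j a => sval (m i j a)).
have ng i j (a : arrow i j) y : g j (rep_map Y a y) = rep_map Z a (g i y).
  exact/esym/(svalP (m i j a)).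
exists Z, (@RepHom _ _ Y Z g ng) => i; have [surj ex] := gP i.
by split; [apply: injf|apply: ex|apply: surj].
Qed.


(** * Functoriality and right exactness of the tensor product *)

Lemma tensor_ext S X (G : zmodType) (u v : {additive tensor S X -> G}) :
  (forall (i : vertex Q) (s : S i) (x : X i), u (tens s x) = v (tens s x)) ->
  u =1 v.
Proof.
move=> uv; apply: tens_ind => [|t t' Ht Ht'|i s x]; last exact: uv.
  by rewrite !raddf0.
by rewrite !raddfB Ht Ht'.
Qed.

Lemma tensor_map_ext S X Y (f g : rep_hom X Y) :
  f =h g -> tensor_map S f =1 tensor_map S g.
Proof. by move=> fg; apply: tensor_ext => i s x; rewrite !tensor_map_tens fg. Qed.

Lemma tensor_map_id S X : tensor_map S (hid X) =1 id.
Proof. by apply: (@tensor_ext S X _ _ idfun) => i s x; rewrite tensor_map_tens. Qed.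

Lemma tensor_map_comp S X Y Z (g : rep_hom Y Z) (f : rep_hom X Y) t :
  tensor_map S (hcomp g f) t = tensor_map S g (tensor_map S f t).
Proof.
apply: (@tensor_ext S X _ (tensor_map S (hcomp g f))
          (tensor_map S g \o tensor_map S f)) => i s x.
by rewrite /= !tensor_map_tens.
Qed.

Lemma tensor_map_zero S X Y (f : rep_hom X Y) t :
  f =h hzero X Y -> tensor_map S f t = 0.
Proof.
move=> f0; apply: (@tensor_ext S X _ (tensor_map S f) \0) => i s x.
by rewrite tensor_map_tens f0; apply: (raddf0 (tensor_unit_fun s)).
Qed.

(** Surjectivity is clear on generators. For the middle term, let [c] be the projection onto the
    cokernel of S ⊗ f. Sending s to the map z ↦ c (s ⊗ y), with y above z, defines by adjunction a
    map on S ⊗ Z through which [c] factors. So [c] kills the kernel of S ⊗ g, which therefore lies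
    in the image of S ⊗ f. *)
Lemma tensor_right_exact S X Y Z (f : rep_hom X Y) (g : rep_hom Y Z) :
  ses f g ->
  (forall t, tensor_map S g t = 0 <-> exists x, tensor_map S f x = t) /\
  (forall t, exists y, tensor_map S g y = t).
Proof.
move=> fg; have gsurj i : forall z, exists y, g i y = z by case: (fg i).
have gf i y : g i y = 0 <-> exists x, f i x = y by case: (fg i).
split; last first.
  apply: tens_ind => [|_ _ [y <-] [y' <-]|i s z].
  - by exists 0; rewrite raddf0.
  - by exists (y - y'); rewrite raddfB.
  - by have [y <-] := gsurj i z; exists (tens s y); rewrite tensor_map_tens.
pose c := coker_pi (tensor_map S f).
have cf x : c (tensor_map S f x) = 0 by apply/coker_pi_eq0; exists x.
have b i (s : S i) : {b : homZ (Z i) (coker (tensor_map S f)) |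
    forall y, b (g i y) = c (tens s y)}.
  (* The class of s ⊗ y depends only on g y, since two preimages differ by some f x and [c] kills s
     ⊗ f x. *)
  have [r rK] := choice (gsurj i).
  have cr y z : g i y = z -> c (tens s (r z)) = c (tens s y).
    move=> yz; have /gf[x fx] : g i (y - r z) = 0 by rewrite linearB yz rK subrr.
    have -> : y = f i x + r z by rewrite fx subrK.
    by rewrite tensDr raddfD -tensor_map_tens cf add0r.
  have add : zmod_morphism (fun z => c (tens s (r z))).
    move=> z z'; rewrite -raddfB; rewrite -(raddfB (tensor_unit_fun s)).
    by apply: cr; rewrite linearB !rK.
  have [h hE] := exists_additive add.
  by exists h => y; apply: etrans (hE _) _; apply: cr.
pose beta i (s : S i) : homZ (Z i) (coker (tensor_map S f)) := sval (b i s).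
have betaE i s y : beta i s (g i y) = c (tens s y) := svalP (b i s) y.
have lin i : linear (beta i).
  move=> r s s'; apply: homZ_ext => z; have [y <-] := gsurj i z.
  rewrite homZ_addE (@homZ_scaleE R) betaE -linearZ !betaE.
  by rewrite tensDl tensZ raddfD.
have nat (i j : vertex (opq Q)) (a : arrow i j) (s : S i) :
    beta j (rep_map S a s) = rep_map (hom_rep Z _) a (beta i s).
  apply: homZ_ext => z; have [y <-] := gsurj j z.
  by rewrite betaE (@tens_map Q R S Y j i a) -betaE hom_nat.
have [B BE] :=
  @exists_rep_hom (opq Q) (opr R) S (hom_rep Z _) beta lin nat.
have BgE t : tensor_lift B (tensor_map S g t) = c t.
  apply: (@tensor_ext S Y _ (tensor_lift B \o tensor_map S g) c) => i s y.
  by rewrite [LHS]/= tensor_map_tens [LHS]tensor_lift_tens BE betaE.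
move=> t; split=> [gt0 | [x <-]].
  by apply/coker_pi_eq0; rewrite -[LHS]BgE gt0 raddf0.
rewrite -tensor_map_comp; apply: tensor_map_zero => i y /=.
by apply/gf; exists y.
Qed.

(** * Pure monomorphisms *)

Definition pure_mono X Y (f : rep_hom X Y) : Prop :=
  forall S : rep (opq Q) (opr R), injective (tensor_map S f).

Lemma pure_sesP X Y Z (f : rep_hom X Y) (g : rep_hom Y Z) :
  pure_ses f g <-> ses f g /\ pure_mono f.
Proof.
split=> -[fg pf]; split=> // S; first by case: (pf S).
have [ex surj] := tensor_right_exact S fg.
by split; [apply: pf|apply: ex|apply: surj].
Qed.


Lemma pure_mono_eq X Y (f g : rep_hom X Y) : f =h g -> pure_mono f -> pure_mono g.
Proof. by move=> fg pf S t t'; rewrite -!(tensor_map_ext fg); apply: pf. Qed.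

Lemma pure_mono_comp X Y Z (g : rep_hom Y Z) (f : rep_hom X Y) :
  pure_mono g -> pure_mono f -> pure_mono (hcomp g f).
Proof.
move=> pg pf S t t' gft; apply: (pf S); apply: (pg S).
by rewrite -!tensor_map_comp.
Qed.

Lemma pure_mono_cancel X Y Z (g : rep_hom Y Z) (f : rep_hom X Y) :
  pure_mono (hcomp g f) -> pure_mono f.
Proof.
by move=> pgf S t t' ft; apply: (pgf S); rewrite 2!tensor_map_comp ft.
Qed.

Lemma pure_mono_id X : pure_mono (hid X).
Proof. by move=> S t t'; rewrite !tensor_map_id. Qed.

Lemma pure_mono_section X Y (r : rep_hom Y X) (s : rep_hom X Y) :
  hcomp r s =h hid X -> pure_mono s.
Proof.
move=> rs; apply: (@pure_mono_cancel _ _ _ r).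
exact: (pure_mono_eq (fun i x => esym (rs i x)) (@pure_mono_id X)).
Qed.

(** A chase after tensoring: an element killed by [m] is killed by [g], because [b] stays injective;
    so it comes from [X], where [m] after [f] is injective. *)
Lemma pure_mono_ses X Y Z W V (f : rep_hom X Y) (g : rep_hom Y Z)
    (m : rep_hom Y W) (a : rep_hom W V) (b : rep_hom Z V) :
  ses f g -> hcomp a m =h hcomp b g -> pure_mono (hcomp m f) -> pure_mono b ->
  pure_mono m.
Proof.
move=> fg am pmf pb S; apply: raddf_inj => y my0.
have [/(_ y)[+ _] _] := tensor_right_exact S fg.
case=> [|x xy].
  apply: (pb S); rewrite raddf0 -tensor_map_comp -(tensor_map_ext am).
  by rewrite tensor_map_comp my0 raddf0.
rewrite -xy; suff -> : x = 0 by rewrite raddf0.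
by apply: (pmf S); rewrite tensor_map_comp xy my0 raddf0.
Qed.

(** * Biproducts and injective representations *)

Definition biprod X Y : rep Q R :=
  @Rep Q R (fun i => (X i * Y i)%type)
    (fun i j a => pair_map (rep_map X a) (rep_map Y a)).

Definition hfst X Y : rep_hom (biprod X Y) X :=
  @RepHom Q R (biprod X Y) X (fun i => fst) (fun i j a x => erefl).

Definition hsnd X Y : rep_hom (biprod X Y) Y :=
  @RepHom Q R (biprod X Y) Y (fun i => snd) (fun i j a x => erefl).

Lemma exists_pairing W X Y (f : rep_hom W X) (g : rep_hom W Y) :
  exists h : rep_hom W (biprod X Y), forall i w, h i w = (f i w, g i w).
Proof.
have lin i : linear (fun w => (f i w, g i w) : biprod X Y i).
  by move=> r w w'; rewrite !linearP.
have [|h hE] := @exists_rep_hom _ _ W (biprod X Y) _ lin.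
  by move=> i j a w /=; rewrite /pair_map /= !hom_nat.
by exists h.
Qed.

(** Injectivity is defined through categorical monomorphisms; vertexwise injective morphisms are
    left cancellable. *)
Lemma injective_extend X Y E (f : rep_hom X Y) (g : rep_hom X E) :
  injective_rep E -> (forall i, injective (f i)) ->
  exists h : rep_hom Y E, hcomp h f =h g.
Proof.
by move=> injE injf; apply: injE => W u v uv i w; apply: injf; apply: uv.
Qed.

Lemma injective_biprod E E' :
  injective_rep E -> injective_rep E' -> injective_rep (biprod E E').
Proof.
move=> injE injE' X Y f fmono g.
have [h hf] := injE _ _ _ fmono (hcomp (hfst E E') g).
have [h' hf'] := injE' _ _ _ fmono (hcomp (hsnd E E') g).
have [k kE] := exists_pairing h h'; exists k => i x.
by rewrite /= kE; move: (hf i x) (hf' i x) => /= -> ->; rewrite -surjective_pairing.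
Qed.

(** * Composite embeddings and the horseshoe lemma *)

(** This is the third isomorphism theorem: for X ⊂ Y ⊂ E, the quotient L = E/X is an extension of K
    = E/Y by C = Y/X. *)
Lemma ses_comp X Y E C K (f : rep_hom X Y) (c : rep_hom Y C)
    (e : rep_hom Y E) (p : rep_hom E K) :
  ses f c -> ses e p ->
  exists L (q : rep_hom E L) (u : rep_hom C L) (v : rep_hom L K),
    ses (hcomp e f) q /\ ses u v.
Proof.
move=> fc ep.
have [i|L [q efq]] := @exists_rep_coker _ _ (hcomp e f).
  by apply: inj_comp; [case: (ep i)|case: (fc i)].
have [i c'|i y|u uE] := @rep_factor _ _ _ c (hcomp q e).
- by case: (fc i).
- case: (fc i) => _ /(_ y)[+ _] _ => /[apply] -[x <-].
  by case: (efq i) => _ /(_ (e i (f i x)))[_ +] _; apply; exists x.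
have [i l|i y|v vE] := @rep_factor _ _ _ q p.
- by case: (efq i).
- case: (efq i) => _ /(_ y)[+ _] _ => /[apply] -[x <-].
  by case: (ep i) => _ /(_ (e i (f i x)))[_ +] _; apply; exists (f i x).
exists L, q, u, v; split=> // i.
have [finj fcE csurj] := fc i; have [einj epE psurj] := ep i.
have [_ qE qsurj] := efq i; split.
- apply: linear_inj => c'; have [y <-] := csurj c'.
  rewrite uE => /qE[x /= /einj xy]; apply/fcE; by exists x.
- move=> l; split=> [|[c' <-]].
    have [z <-] := qsurj l; rewrite vE => /epE[y <-].
    by exists (c i y); rewrite uE.
  have [y <-] := csurj c'; rewrite uE vE; apply/epE; by exists y.
- by move=> k; have [z <-] := psurj k; exists (q i z); apply: vE.
Qed.

Lemma pure_ses_comp X Y E C K (f : rep_hom X Y) (c : rep_hom Y C)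
    (e : rep_hom Y E) (p : rep_hom E K) :
  pure_ses f c -> pure_ses e p ->
  exists L (q : rep_hom E L) (u : rep_hom C L) (v : rep_hom L K),
    pure_ses (hcomp e f) q /\ ses u v.
Proof.
move=> /pure_sesP[fc pf] /pure_sesP[ep pe].
have [L [q [u [v [efq uv]]]]] := ses_comp fc ep.
exists L, q, u, v; split=> //; apply/pure_sesP; split=> //.
exact: pure_mono_comp.
Qed.

(* The map E + Z -> K is (w, z) |-> p w - p (h y) for any y above z. *)
Lemma pure_ses_pairing X Y Z E K (f : rep_hom X Y) (g : rep_hom Y Z)
    (e : rep_hom X E) (p : rep_hom E K) (h : rep_hom Y E) :
  ses f g -> pure_ses e p -> hcomp h f =h e ->
  exists (m : rep_hom Y (biprod E Z)) (q : rep_hom (biprod E Z) K),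
    pure_ses m q.
Proof.
move=> fg /pure_sesP[ep pe] hf.
have [m mE] := exists_pairing h g.
have [i z|i y|k kE] := @rep_factor _ _ _ g (hcomp p h).
- by case: (fg i).
- case: (fg i) => _ /(_ y)[+ _] _ => /[apply] -[x <-].
  case: (ep i) => _ /(_ (e i x))[_ +] _ => <-; last by exists x.
  by rewrite -hf.
have lin i : linear (fun x : biprod E Z i => p i x.1 - k i x.2).
  exact: (linearP ((p i \o fst) \- (k i \o snd) : {linear _ -> _})).
have [|q qE] := @exists_rep_hom _ _ (biprod E Z) K _ lin.
  by move=> i j a x /=; rewrite !hom_nat linearB.
exists m, q; apply/pure_sesP; split=> [i|].
  have [finj fgE gsurj] := fg i; have [einj epE psurj] := ep i; split.
  - apply: linear_inj => y; rewrite mE => -[hy0 /fgE[x xy]].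
    rewrite -xy; suff -> : x = 0 by rewrite linear0.
    by apply: einj; rewrite linear0 -hf /= xy.
  - case=> w z; rewrite qE /=; split=> [/eqP|[y]]; last first.
      by rewrite mE => -[<- <-]; rewrite kE subrr.
    have [y <-] := gsurj z; rewrite kE subr_eq0 => /eqP pw.
    have /epE[x xw] : p i (w - h i y) = 0 by rewrite linearB pw subrr.
    (* Adding f x leaves g y unchanged and corrects the first component by e x = w - h y. *)
    exists (y + f i x); rewrite mE !linearD.
    have -> : g i (f i x) = 0 by apply/fgE; exists x.
    by have /= -> := hf i x; rewrite xw addr0 addrC subrK.
  - move=> w; have [z <-] := psurj w; exists (z, 0).
    by rewrite qE /= linear0 subr0.
(* On [X] the first component of [m] is the pure monomorphism [e]; on the quotient [Z] the second
   component induces the identity. *)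
apply: (@pure_mono_ses _ _ _ _ _ f g m (hsnd E Z) (hid Z)) => //.
- by move=> i y /=; rewrite mE.
- apply: (@pure_mono_cancel _ _ _ (hfst E Z)); apply: pure_mono_eq pe => i x.
  by rewrite /= mE /= -hf.
- exact: pure_mono_id.
Qed.

(** The embedding is the identity of [E] plus [e]. Its purity is tested along the split sequence 0 →
    E → E + Z → Z → 0: it is split on [E] and induces [e] on [Z]. *)
Lemma pure_ses_biprod E Z E' K (e : rep_hom Z E') (p : rep_hom E' K) :
  pure_ses e p ->
  exists (m : rep_hom (biprod E Z) (biprod E E')) (q : rep_hom (biprod E E') K),
    pure_ses m q.
Proof.
move=> /pure_sesP[ep pe].
have [m mE] := exists_pairing (hfst E Z) (hcomp e (hsnd E Z)).
have [s sE] := exists_pairing (hid E) (hzero E Z).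
have ses_s : ses s (hsnd E Z).
  move=> i; split=> [x y|[x z]|z]; first by rewrite !sE => -[].
    split=> [/= ->|[x' <-]]; last by rewrite sE.
    by exists x; rewrite sE.
  by exists (0, z).
exists m, (hcomp p (hsnd E E')); apply/pure_sesP; split=> [i|].
  have [einj epE psurj] := ep i; split.
  - by move=> [x z] [x' z']; rewrite !mE /= => -[-> /einj ->].
  - case=> x w /=; split=> [/epE[z <-]|[[x' z]]].
      by exists (x, z); rewrite mE.
    by rewrite mE /= => -[_ <-]; apply/epE; exists z.
  - by move=> w; have [z <-] := psurj w; exists (0, z).
apply: (@pure_mono_ses _ _ _ _ _ s (hsnd E Z) m (hsnd E E') e) => //.
- by move=> i y /=; rewrite mE.
- apply: (@pure_mono_section _ _ (hfst E E')) => i x.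
  by rewrite /= mE /= sE.
Qed.

(** The pure embeddings Y → E + Z → E + E' have cokernels [K] and [K'], so the cokernel of the
    composite is an extension of [K'] by [K]. *)
Lemma horseshoe X Y Z E E' K K' (f : rep_hom X Y) (g : rep_hom Y Z)
    (e : rep_hom X E) (p : rep_hom E K)
    (e' : rep_hom Z E') (p' : rep_hom E' K') :
  ses f g -> pure_ses e p -> injective_rep E -> pure_ses e' p' ->
  exists C (m : rep_hom Y (biprod E E')) (q : rep_hom (biprod E E') C)
    (u : rep_hom K C) (v : rep_hom C K'), pure_ses m q /\ ses u v.
Proof.
move=> fg ep injE ep'.
have [|h hf] := @injective_extend _ _ _ f e injE.
  by move=> i; case: (fg i).
have [m [q mq]] := pure_ses_pairing fg ep hf.
have [m' [q' mq']] := pure_ses_biprod E ep'.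
have [C [s [u [v [ms uv]]]]] := pure_ses_comp mq mq'.
by exists C, (hcomp m' m), s, u, v.
Qed.

(** * Pure coresolutions by a class, and coinduction *)

(** For [T] the injectives this is [strongly_fp_injective]; for [T] the strongly fp-injectives it is
    the condition in the last clause of the theorem. *)
Definition resolved (T : rep Q R -> Prop) X : Prop :=
  exists (E : nat -> rep Q R) (eps : rep_hom X (E 0%N))
         (d : forall n, rep_hom (E n) (E n.+1)),
    pure_exact eps d /\ forall n, T (E n).

(** Since [j n] is injective, [d n] has the kernel of [p n]; since [p n] is surjective, [d n] has
    the image of [j n]. *)
Lemma long_exact_splice X (E K : nat -> rep Q R) (eps : rep_hom X (E 0%N))
    (d : forall n, rep_hom (E n) (E n.+1))
    (p : forall n, rep_hom (E n) (K n)) (j : forall n, rep_hom (K n) (E n.+1)) :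
  (forall n, d n =h hcomp (j n) (p n)) -> ses eps (p 0%N) ->
  (forall n, ses (j n) (p n.+1)) -> long_exact eps d.
Proof.
move=> dE ep jp.
have d0 n i y : d n i y = 0 <-> p n i y = 0.
  rewrite dE /=; have [jinj _ _] := jp n i; split=> [|->]; last by rewrite linear0.
  by rewrite -(linear0 (j n i)) => /jinj.
split=> [i|i y|n i y]; first by case: (ep i).
  by rewrite d0; case: (ep i).
have [_ pE psurj] := jp n i; rewrite d0 pE; split=> -[k <-]; last first.
  by exists (p n i k); rewrite dE.
(* For n = 0 the surjectivity comes from the sequence starting at [X], otherwise from the one
   starting at K (n - 1). *)
have psurj' : exists y, p n i y = k.
  by case: n {dE d0 y pE psurj} k => [|n] k; [case: (ep i)|case: (jp n i)].
by have [z <-] := psurj'; exists z; rewrite dE.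
Qed.

Lemma resolved_unfold T X : resolved T X ->
  exists E K (e : rep_hom X E) (p : rep_hom E K),
    [/\ pure_ses e p, T E & resolved T K].
Proof.
move=> [E [eps [d [[_ [K [p [j [dE ep jp]]]]] TE]]]].
exists (E 0%N), (K 0%N), eps, (p 0%N); split=> //.
(* The tail of the sequence, augmented by [j 0], coresolves [K 0]. *)
exists (fun n => E n.+1), (j 0%N), (fun n => d n.+1); split=> //; split.
  apply: (@long_exact_splice _ _ (fun n => K n.+1) _ _ (fun n => p n.+1)
    (fun n => j n.+1)) => // [|n].
    by case: (jp 0%N).
  by case: (jp n.+1).
by exists (fun n => K n.+1), (fun n => p n.+1), (fun n => j n.+1).
Qed.

(** Iterating the step from [X] yields short pure sequences, each starting at the cokernel of the
    previous one; splicing them gives the coresolution. *)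
Lemma resolved_coind (T P : rep Q R -> Prop) :
  (forall X, P X -> exists E K (e : rep_hom X E) (p : rep_hom E K),
    [/\ pure_ses e p, T E & P K]) ->
  forall X, P X -> resolved T X.
Proof.
move=> step X PX.
(* A state carries its proof of [P], and [cid] turns the step into data, so that the states [k n]
   can be defined by recursion. *)
have st (s : {X | P X}) : {E : rep Q R & {K : {K | P K} &
    {e : rep_hom (sval s) E & {p : rep_hom E (sval K) | pure_ses e p /\ T E}}}}.
  have /cid[E /cid[K /cid[e /cid[p [ep TE PK]]]]] := step _ (svalP s).
  by exists E, (exist P K PK), e, p.
pose k := fix k n := if n is m.+1 then tag (tagged (st (k m)))
                     else exist P X PX.
pose E n := tag (st (k n)).
pose e n : rep_hom (sval (k n)) (E n) := tag (tagged (tagged (st (k n)))).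
pose p n : rep_hom (E n) (sval (k n.+1)) :=
  sval (tagged (tagged (tagged (st (k n))))).
have epT n : pure_ses (e n) (p n) /\ T (E n) :=
  svalP (tagged (tagged (tagged (st (k n))))).
exists E, (e 0%N), (fun n => hcomp (e n.+1) (p n)); split; last first.
  by move=> n; case: (epT n).
have ep n : pure_ses (e n) (p n) by case: (epT n).
split.
  apply: (@long_exact_splice _ _ (fun n => sval (k n.+1)) _ _ p
    (fun n => e n.+1)) => // [|n]; first by case: (ep 0%N).
  by case: (ep n.+1).
exists (fun n => sval (k n.+1)), p, (fun n => e n.+1); split=> //.
exact: (ep 0%N).
Qed.

(** The class [P] of representations with one step into [resolved T] contains [resolved T] by
    unfolding, so coinduction applies to it. *)
Lemma resolved_fold (T : rep Q R -> Prop) X E K (e : rep_hom X E)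
    (p : rep_hom E K) :
  pure_ses e p -> T E -> resolved T K -> resolved T X.
Proof.
move=> ep TE TK.
pose P X := exists E K (e : rep_hom X E) (p : rep_hom E K),
  [/\ pure_ses e p, T E & resolved T K].
apply: (@resolved_coind T P); last by exists E, K, e, p.
move=> Y [E' [K' [e' [p' [ep' TE' TK']]]]].
by exists E', K', e', p'; split=> //; apply: resolved_unfold.
Qed.

(** * Extensions, retracts, cokernels and pure kernels *)

Notation sfpi := (@strongly_fp_injective Q R).

Lemma sfpi_unfold X : sfpi X ->
  exists E K (e : rep_hom X E) (p : rep_hom E K),
    [/\ pure_ses e p, injective_rep E & sfpi K].
Proof. exact: resolved_unfold. Qed.

Lemma sfpi_fold X E K (e : rep_hom X E) (p : rep_hom E K) :
  pure_ses e p -> injective_rep E -> sfpi K -> sfpi X.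
Proof. exact: resolved_fold. Qed.

(** Coinduction on the class of such extensions: the horseshoe cokernel [C] is an extension of [K']
    by [K], hence again in the class. *)
Lemma sfpi_extension X Y Z (f : rep_hom X Y) (g : rep_hom Y Z) :
  ses f g -> sfpi X -> sfpi Z -> sfpi Y.
Proof.
move=> fg sX sZ.
pose P Y := exists X Z (f : rep_hom X Y) (g : rep_hom Y Z),
  [/\ ses f g, sfpi X & sfpi Z].
apply: (@resolved_coind _ P); last by exists X, Z, f, g.
move=> {X Y Z f g fg sX sZ} Y [X [Z [f [g [fg sX sZ]]]]].
have [E [K [e [p [ep injE sK]]]]] := sfpi_unfold sX.
have [E' [K' [e' [p' [ep' injE' sK']]]]] := sfpi_unfold sZ.
have [C [m [q [u [v [mq uv]]]]]] := horseshoe fg ep injE ep'.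
exists (biprod E E'), C, m, q; split=> //; first exact: injective_biprod.
by exists K, K', u, v.
Qed.

(* Write L for the cokernel of X -> W -> E, with W -> E -> K a first step of a
   resolution of W.  Then X + L is an extension of K by W, so that L is again a
   retract of a strongly fp-injective representation. *)
Lemma sfpi_retract X W (s : rep_hom X W) (r : rep_hom W X) :
  hcomp r s =h hid X -> sfpi W -> sfpi X.
Proof.
move=> rs sW.
pose P X := exists W (s : rep_hom X W) (r : rep_hom W X),
  hcomp r s =h hid X /\ sfpi W.
apply: (@resolved_coind _ P); last by exists W, s, r.
move=> {X W s r rs sW} X [W [s [r [rs sW]]]].
have [E [K [e [p [/pure_sesP[ep pe] injE sK]]]]] := sfpi_unfold sW.
have pes : pure_mono (hcomp e s).
  exact/(pure_mono_comp pe)/(pure_mono_section rs).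
have einj i : injective (e i) by case: (ep i).
have [|L [q esq]] := @exists_rep_coker _ _ (hcomp e s).
  by move=> i x y /= /einj xy; rewrite -[x]rs -[y]rs /= xy.
exists E, L, (hcomp e s), q; split=> //; first exact/pure_sesP.
have [i l|i y|k kE] := @rep_factor _ _ _ q p.
- by case: (esq i).
- case: (esq i) => _ /(_ y)[+ _] _ => /[apply] -[x <-].
  by case: (ep i) => _ /(_ (e i (s i x)))[_ +] _; apply; exists (s i x).
have [m mE] := exists_pairing r (hcomp q e).
have [t tE] := exists_pairing (hzero L X) (hid L).
exists (biprod X L), t, (hsnd X L); split=> [i l|]; first by rewrite /= tE.
apply: (@sfpi_extension _ _ _ m (hcomp k (hsnd X L)) _ sW sK) => i.
have [_ epE psurj] := ep i; have [_ qE qsurj] := esq i.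
have rsE x : r i (s i x) = x := rs i x.
have qes x : q i (e i (s i x)) = 0 by apply/qE; exists x.
split.
- apply: linear_inj => w; rewrite mE => -[rw0 /qE[x /= /einj xw]].
  by rewrite -xw -[x]rsE xw rw0 linear0.
- case=> x l /=; split=> [|[w]]; last first.
    by rewrite mE => -[_ <-] /=; rewrite kE; apply/epE; exists w.
  have [y <-] := qsurj l; rewrite kE => /epE[w <-].
  (* The correction lies in the image of [s], which q ∘ e kills, and brings the first component from
     r w to x. *)
  exists (w + s i (x - r i w)); rewrite mE /= (linearD (r i)) rsE addrC subrK.
  by rewrite (linearD (e i)) (linearD (q i)) qes addr0.
- move=> c; have [y <-] := psurj c; exists (0, q i y).
  by rewrite /= kE.
Qed.

Lemma sfpi_coker X Y Z (f : rep_hom X Y) (g : rep_hom Y Z) :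
  ses f g -> sfpi X -> sfpi Y -> sfpi Z.
Proof.
move=> fg sX sY.
have [E [K [e [p [ep injE sK]]]]] := sfpi_unfold sX.
have [|h hf] := @injective_extend _ _ _ f e injE.
  by move=> i; case: (fg i).
have [m [q /pure_sesP[mq _]]] := pure_ses_pairing fg ep hf.
have [t tE] := exists_pairing (hzero Z E) (hid Z).
apply: (@sfpi_retract _ (biprod E Z) t (hsnd E Z)).
  by move=> i z; rewrite /= tE.
exact: (sfpi_extension mq sY sK).
Qed.

(** Embed [Y] purely in an injective [E] with cokernel [K]. The composite X → E is pure, and its
    cokernel is an extension of [K] by [Z]. *)
Lemma sfpi_pure_kernel X Y Z (f : rep_hom X Y) (g : rep_hom Y Z) :
  pure_ses f g -> sfpi Y -> sfpi Z -> sfpi X.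
Proof.
move=> fg sY sZ.
have [E [K [e [p [ep injE sK]]]]] := sfpi_unfold sY.
have [L [q [u [v [efq uv]]]]] := pure_ses_comp fg ep.
by apply: (sfpi_fold efq) => //; apply: (sfpi_extension uv).
Qed.

(** * The zero representation, finite direct sums and coresolutions by strongly fp-injectives *)

Definition zero_rep : rep Q R :=
  @Rep Q R (fun=> 'rV[R]_0) (fun i j a => \0).

Lemma injective_zero_rep : injective_rep zero_rep.
Proof.
move=> X Y f _ g; exists (hzero Y zero_rep) => i x /=.
exact/esym/thinmx0.
Qed.

(** The coresolution is [E] followed by zeros; coinduction runs on the class of injectives, which
    contains zero. *)
Lemma injective_sfpi E : injective_rep E -> sfpi E.
Proof.
apply: resolved_coind => {}E injE.
exists E, zero_rep, (hid E), (hzero E zero_rep); split=> //.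
  apply/pure_sesP; split; last exact: pure_mono_id.
  move=> i; split=> // [x|x]; last by exists 0; rewrite [x]thinmx0.
  by split=> // _; exists x.
exact: injective_zero_rep.
Qed.

(** Iterated biproducts along [enum I] give a strongly fp-injective [B] and maps W → B → W composing
    to the partial sums of [inc k] after [pr k]. The full sum is the identity, so [W] is a retract
    of [B]. *)
Lemma sfpi_direct_sum (I : finType) (X : I -> rep Q R) W :
  direct_sum X W -> (forall k, sfpi (X k)) -> sfpi W.
Proof.
move=> [inc [pr [_ _ incpr]]] sX.
have [B [u [v [sB vu]]]] : exists B (u : rep_hom W B) (v : rep_hom B W),
    sfpi B /\ forall i w, v i (u i w) = \sum_(k <- enum I) inc k i (pr k i w).
  elim: (enum I) => [|k s [B [u [v [sB vu]]]]].
    exists zero_rep, (hzero W zero_rep), (hzero zero_rep W); split.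
      exact/injective_sfpi/injective_zero_rep.
    by move=> i w; rewrite big_nil.
  have [u' u'E] := exists_pairing (pr k) u.
  have lin i : linear (fun x : biprod (X k) B i => inc k i x.1 + v i x.2).
    exact: (linearP ((inc k i \o fst) \+ (v i \o snd) : {linear _ -> _})).
  have [|v' v'E] := @exists_rep_hom _ _ (biprod (X k) B) W _ lin.
    by move=> i j a x /=; rewrite !hom_nat linearD.
  exists (biprod (X k) B), u', v'; split=> [|i w]; last first.
    by rewrite big_cons v'E u'E /= vu.
  have [t tE] := exists_pairing (hid (X k)) (hzero (X k) B).
  apply: (@sfpi_extension _ _ _ t (hsnd (X k) B)) => // i.
  split=> [x y|[x b]|b]; first by rewrite !tE => -[].
    split=> [/= ->|[x' <-]]; last by rewrite tE.
    by exists x; rewrite tE.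
  by exists (0, b).
apply: (@sfpi_retract _ _ u v) => // i w /=.
by rewrite vu big_enum incpr.
Qed.

(* The class of extensions of resolved sfpi representations by sfpi ones is
   stable under the cokernel C of the horseshoe embedding: C has a filtration
   with factors A1, K, K', the last two of which are sfpi. *)
Lemma resolved_sfpi X : resolved sfpi X -> sfpi X.
Proof.
move=> rX.
pose P X := exists A B (f : rep_hom A X) (g : rep_hom X B),
  [/\ ses f g, resolved sfpi A & sfpi B].
apply: (@resolved_coind _ P); last first.
  exists X, zero_rep, (hid X), (hzero X zero_rep); split=> //.
    move=> i; split=> // [x|x]; last by exists 0; rewrite [x]thinmx0.
    by split=> // _; exists x.
  exact/injective_sfpi/injective_zero_rep.
move=> {X rX} X [A [B [f [g [fg rA sB]]]]].
have [T [A1 [a [c [ac sT rA1]]]]] := resolved_unfold rA.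
have [E [K [e [p [ep injE sK]]]]] := sfpi_unfold sT.
(* Composing A → T → E replaces [T] by the injective [E], at the price of a cokernel [L] that is an
   extension of [K] by [A1]. *)
have [L [q [u [v [eaq uv]]]]] := pure_ses_comp ac ep.
have [E' [K' [e' [p' [ep' injE' sK']]]]] := sfpi_unfold sB.
have [C [m [r [u' [v' [mr uv']]]]]] := horseshoe fg eaq injE ep'.
exists (biprod E E'), C, m, r; split=> //; first exact: injective_biprod.
have [M [b [x [y [ub xy]]]]] := ses_comp uv uv'.
exists A1, M, (hcomp u' u), b; split=> //.
exact: (sfpi_extension xy).
Qed.

End Representations.

Theorem theoremA (R : pzRingType) (Q : quiver) :
  ((forall (X Y Z : rep Q R) (f : rep_hom X Y) (g : rep_hom Y Z), ses f g ->
      strongly_fp_injective X -> strongly_fp_injective Z ->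
      strongly_fp_injective Y)
   /\ (forall (I : finType) (X : I -> rep Q R) (W : rep Q R),
      direct_sum X W -> (forall k, strongly_fp_injective (X k)) ->
      strongly_fp_injective W)
   /\ (forall X Y : rep Q R, direct_summand X Y ->
      strongly_fp_injective Y -> strongly_fp_injective X))
  /\ (forall (X Y Z : rep Q R) (f : rep_hom X Y) (g : rep_hom Y Z), ses f g ->
      strongly_fp_injective X -> strongly_fp_injective Y ->
      strongly_fp_injective Z)
  /\ (forall (X Y Z : rep Q R) (f : rep_hom X Y) (g : rep_hom Y Z), pure_ses f g ->
      strongly_fp_injective Y -> strongly_fp_injective Z ->
      strongly_fp_injective X)
  /\ (forall X : rep Q R, strongly_fp_injective X <->
      exists (T : nat -> rep Q R) (eps : rep_hom X (T 0%N))
             (d : forall n, rep_hom (T n) (T n.+1)),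
        pure_exact eps d /\ forall n, strongly_fp_injective (T n)).
Proof.
split; [split; [exact: sfpi_extension|split] | split; [|split]].
- exact: sfpi_direct_sum.
- move=> X Y [X' [inc [pr [princ _ _]]]].
  exact: (@sfpi_retract Q R X Y (inc true) (pr true) (princ true)).
- exact: sfpi_coker.
- exact: sfpi_pure_kernel.
- move=> X; split=> [|/resolved_sfpi //].
  move=> [E [eps [d [ex injE]]]]; exists E, eps, d; split=> // n.
  exact: injective_sfpi.
Qed.
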